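(* Consider a generalized Nash equilibrium problem GNEP$(\theta_i,K_i)_{i\in\Lambda}$ (notation in the context) in which each $C_i\subseteq\mathbb{R}^{n_i}$ is a non-empty closed convex set and $K_i(x)\subseteq\mathbb{R}^{n_i}$ is non-empty, closed and convex for every $x\in\mathcal{C}=\prod_{i}C_i$. Let $\mathcal{K}(x)=\prod_{i\in\Lambda}K_i(x)$, $\mathcal{A}=\overline{\mathrm{co}}(\mathcal{K}(\mathcal{C}))$, $G(x)=(-\nabla_{x_i}\theta_i(x))_{i\in\Lambda}$ and $$f(y,z)=\sum_{i\in\Lambda}\langle-\nabla_{y_i}\theta_i(y),z_i-y_i\rangle .$$ Assume that: (i) each $\theta_i:\mathbb{R}^n\to\mathbb{R}$ is continuously differentiable and $\theta_i(\cdot,x_{-i})$ is concave for every $x_{-i}$; (ii) there is $L>0$ such that $\|G(y)-G(z)\|\le L\|y-z\|$ for all $y,z\in\mathcal{A}$; (iii) there is $\mu>0$ such that $f(x,y)+f(y,x)\le-\mu\|x-y\|^2$ for all $x,y\in\mathcal{A}$; (iv) there is $\alpha\in(0,\frac{\mu}{L})$ such that $\|P_{\mathcal{K}(u)}(z)-P_{\mathcal{K}(v)}(z)\|\le\alpha\|u-v\|$ for all $u,v\in\mathcal{C}$ and $z\in\mathbb{R}^n$. Then there exists a unique projected solution $\bar x$ for GNEP$(\theta_i,K_i)_{i\in\Lambda}$. Further, for every $y_0\in\mathbb{R}^n$ the sequence $(x_k)$ generated by the outer algorithm described in the context converges to $\bar x$, with $$\|x_k-\bar x\|\le\frac1\delta\exp\left\{-\frac\delta2k\right\}\|y_0-T(x_0)\|\quad\text{for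 all }k\ge0,\qquad\delta=1-\alpha\frac L\mu,$$ where $T(x)$ denotes the unique point of $\mathcal{K}(x)$ with $f(T(x),z)\ge0$ for all $z\in\mathcal{K}(x)$.
   Context: $\Lambda$ is a finite set of players; player $i$ controls $x_i\in C_i\subseteq\mathbb{R}^{n_i}$, $\sum_in_i=n$, and $x=(x_i,x_{-i})$. $K_i:\mathcal{C}\rightrightarrows\mathbb{R}^{n_i}$ is the feasible strategy map and $\theta_i:\mathbb{R}^n\to\mathbb{R}$ the objective to be maximized by player $i$. $P_X$ is the Euclidean projection onto $X$; $\overline{\mathrm{co}}$ is the closure of the convex hull; $\mathcal{K}(\mathcal{C})=\bigcup_{x\in\mathcal{C}}\mathcal{K}(x)$. $\bar x\in\mathcal{C}$ is a projected solution of GNEP$(\theta_i,K_i)_{i\in\Lambda}$ if there is $\bar y\in\mathcal{K}(\bar x)$ with $\|\bar x-\bar y\|=\inf_{y\in\mathcal{C}}\|y-\bar y\|$ and such that $\bar y$ is a Nash equilibrium over the fixed sets $K_i(\bar x)$, i.e. for each $i$, $\bar y_i$ maximizes $\theta_i(\cdot,\bar y_{-i})$ over $K_i(\bar x)$. Inner algorithm: given a non-empty closed convex $\mathcal{D}\subseteq\mathcal{A}$, a point $\hat y\in\mathcal{D}$ and $N\in\mathbb{N}$, put $\lambda_0=1$ and let $w_0$ be the unique minimizer over $w\in\mathcal{D}$ of $f(\hat y,w)+\frac L2\|w-\hat y\|^2$. For $m=0,\dots,N-1$: let $z_m$ be the unique minimizer over $z\in\mathcal{D}$ of $\sum_{i=0}^m\lambda_i\left[f(w_i,z)+\frac\mu2\|z-w_i\|^2\right]$;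 let $w_{m+1}$ be the unique minimizer over $w\in\mathcal{D}$ of $f(z_m,w)+\frac L2\|w-z_m\|^2$; put $S_m=\sum_{i=0}^m\lambda_i$ and $\lambda_{m+1}=\frac{\mu}{L}S_m$. The output is $\tilde y_N(\mathcal{D},\hat y)=\frac1{S_N}\sum_{i=0}^N\lambda_iw_i$, with $S_N=\sum_{i=0}^N\lambda_i$. Outer algorithm: let $\hat N=\left\lceil\frac{2(L+\mu)}{\mu}\ln\left(\frac{20L}{\mu-\alpha L}\right)\right\rceil$. Given $y_0\in\mathbb{R}^n$, for $k=0,1,2,\dots$ set $x_k=P_{\mathcal{C}}(y_k)$, $\hat y_k=P_{\mathcal{K}(x_k)}(y_k)$, and $y_{k+1}=\tilde y_{\hat N}(\mathcal{K}(x_k),\hat y_k)$. *)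

(* Defs.v *)
From HB Require Import structures.
From mathcomp Require Import all_boot all_order all_algebra.
From mathcomp Require Import all_classical all_reals all_analysis.
Import Order.TTheory GRing.Theory Num.Theory numFieldNormedType.Exports.

Set Implicit Arguments.
Unset Strict Implicit.
Unset Printing Implicit Defensive.

Local Open Scope classical_set_scope.
Local Open Scope ring_scope.

(* R^n with n = \sum_i n_ i, for the players i : 'I_p: the component x_i of x
   is [submxrow x i], and [\mxrow_i u i] is the point with components u i. *)
Notation profile R n_ := 'rV[R]_(\sum_i n_ i)%N (only parsing).

(* Definite description; it takes the value [point] when P does not have
   exactly one witness. *)
Definition the_unique (T : pointedType) (P : T -> Prop) : T := get (unique P).

Section Euclidean.
Context {R : realType} {n : nat}.
Implicit Types u v : 'rV[R]_n.

Definition dot u v : R := \sum_j u 0 j * v 0 j.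

(* The library norm on 'rV[R]_n is the sup norm, which induces the same
   topology. *)
Definition enorm u : R := Num.sqrt (dot u u).

Definition is_argmin (D : set 'rV[R]_n) (g : 'rV[R]_n -> R) w : Prop :=
  D w /\ forall v, D v -> g w <= g v.

Definition argmin D g : 'rV[R]_n := the_unique (is_argmin D g).

Definition metric_proj (X : set 'rV[R]_n) z : 'rV[R]_n :=
  argmin X (fun x => enorm (x - z)).

Definition gradient (g : 'rV[R]_n -> R) u : 'rV[R]_n :=
  \row_j 'D_(delta_mx 0 j) g u.

Definition continuously_differentiable (g : 'rV[R]_n -> R) : Prop :=
  (forall u, differentiable g u) /\ continuous (gradient g).

Definition concave_function (g : 'rV[R]_n -> R) : Prop :=
  convex_function setT (fun u => - g u).

Definition closed_convex_hull (A : set 'rV[R]_n) : set 'rV[R]_n :=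
  closure (smallest (@convex_set R 'rV[R]_n) A).

End Euclidean.

Section GNEP.
Context {R : realType} {p : nat} {n_ : 'I_p -> nat}.
Local Notation E := (profile R n_).
Implicit Types (C : forall i, set 'rV[R]_(n_ i))
  (K : forall i, E -> set 'rV[R]_(n_ i)) (theta : 'I_p -> E -> R) (x y z : E).

(* (u, x_{-i}) *)
Definition deviate x i (u : 'rV[R]_(n_ i)) : E :=
  \mxrow_j eqtype.dfwith (fun j => submxrow x j) u j.

Definition prod_set C : set E := [set x | forall i, C i (submxrow x i)].

Definition feasible K x : set E := prod_set (fun i => K i x).

Definition ambient C K : set E :=
  closed_convex_hull (\bigcup_(x in prod_set C) feasible K x).

Definition pseudo_gradient theta x : E :=
  \mxrow_i - submxrow (gradient (theta i) x) i.

Definition vi_bifunction theta y z : R :=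
  \sum_i dot (- submxrow (gradient (theta i) y) i) (submxrow z i - submxrow y i).

Definition nash_equilibrium (S : forall i, set 'rV[R]_(n_ i)) theta y : Prop :=
  prod_set S y /\
  forall i u, S i u -> theta i (deviate y u) <= theta i y.

Definition projected_solution C K theta x : Prop :=
  prod_set C x /\
  exists y, [/\ feasible K x y,
    enorm (x - y) = inf [set enorm (y' - y) | y' in prod_set C] &
    nash_equilibrium (fun i => K i x) theta y].

Definition VI_solution K (f : E -> E -> R) x : E :=
  the_unique (fun t => feasible K x t /\ forall z, feasible K x z -> 0 <= f t z).

End GNEP.

Section Algorithms.
Context {R : realType} {n : nat}.
Local Notation E := 'rV[R]_n.
Variables (f : E -> E -> R) (L mu : R).

(* [inner_run D yhat m] is the list (lambda_0, w_0), ..., (lambda_m, w_m). *)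
Fixpoint inner_run (D : set E) (yhat : E) (m : nat) : seq (R * E) :=
  let w_step z := argmin D (fun w => f z w + L / 2 * enorm (w - z) ^+ 2) in
  if m is m'.+1 then
    let s := inner_run D yhat m' in
    let z := argmin D (fun z =>
      \sum_(lw <- s) lw.1 * (f lw.2 z + mu / 2 * enorm (z - lw.2) ^+ 2)) in
    rcons s (mu / L * \sum_(lw <- s) lw.1, w_step z)
  else [:: (1, w_step yhat)].

Definition inner_output (D : set E) (yhat : E) (N : nat) : E :=
  let s := inner_run D yhat N in
  (\sum_(lw <- s) lw.1)^-1 *: \sum_(lw <- s) lw.1 *: lw.2.

(* If f is mu-strongly monotone and its operator L-Lipschitz on a set with at
   least two points, then mu <= L and the ceiling is positive; [Num.max 0] only
   matters in the remaining degenerate case. *)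
Definition inner_steps (alpha : R) : nat :=
  absz (Num.max 0 (Num.ceil (2 * (L + mu) / mu * ln (20 * L / (mu - alpha * L))))).

Variables (X : set E) (KK : E -> set E) (N : nat).

Fixpoint outer_y (y0 : E) (k : nat) : E :=
  if k is k'.+1 then
    let y := outer_y y0 k' in
    let x := metric_proj X y in
    inner_output (KK x) (metric_proj (KK x) y) N
  else y0.

Definition outer_x (y0 : E) (k : nat) : E := metric_proj X (outer_y y0 k).

End Algorithms.

(* Main.v *)
(* The fixed-set equilibria over K(x) are the solutions T(x) of the variational
   inequality of the strongly monotone operator G on K(x), so that projected
   solutions are the fixed points of P_C o T.  Writing T(u) as a fixed point of
   the projected gradient step of length s and letting s -> +oo shows that T is
   (alpha L / mu)-Lipschitz, whence P_C o T is a contraction with factor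
   1 - delta.

   For the inner algorithm, the minimum over D of the estimating function
   sum_i lambda_i [f(w_i, z) + mu/2 |z - w_i|^2] is nondecreasing in m: the term
   added at step m + 1 is compensated by the strong convexity of the previous
   sum, because L lambda_{m+1} = mu S_m.  Evaluating the sum at T and using
   Jensen's inequality gives
   S_N |y_N - T|^2 <= (4 (L / mu) |y^ - T|)^2 with S_N = (1 + mu/L)^N, and N^ is
   chosen so that this error is at most (delta/5) |y^ - T|.  Then
   |y_k - T(x_k)| decreases by the factor 1 - delta/2 <= exp(-delta/2) at each
   outer step, and |x_k - xbar| <= |y_k - T(x_k)| / delta. *)

Require Import Defs.
From HB Require Import structures.
From mathcomp Require Import all_boot all_order all_algebra.
From mathcomp Require Import all_classical all_reals all_analysis.
From mathcomp Require Import ring lra.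
Import Order.TTheory GRing.Theory Num.Theory numFieldNormedType.Exports.

Set Implicit Arguments.
Unset Strict Implicit.
Unset Printing Implicit Defensive.

Local Open Scope classical_set_scope.
Local Open Scope ring_scope.

(** * Euclidean inner product and norm; existence of minimizers and fixed points *)

Section EuclideanSpace.
Context {R : realType} {n : nat}.
Implicit Types u v w x y : 'rV[R]_n.

Lemma dotC u v : dot u v = dot v u.
Proof. by apply: eq_bigr => j _; rewrite mulrC. Qed.

Lemma dotDl u v w : dot (u + v) w = dot u w + dot v w.
Proof. by rewrite /dot -big_split; apply: eq_bigr => j _; rewrite mxE mulrDl. Qed.

Lemma dotNl u w : dot (- u) w = - dot u w.
Proof. by rewrite /dot -sumrN; apply: eq_bigr => j _; rewrite mxE mulNr. Qed.

Lemma dotZl c u w : dot (c *: u) w = c * dot u w.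
Proof. by rewrite /dot mulr_sumr; apply: eq_bigr => j _; rewrite mxE mulrA. Qed.

Lemma dotDr u v w : dot w (u + v) = dot w u + dot w v.
Proof. by rewrite !(dotC w) dotDl. Qed.

Lemma dotNr u w : dot w (- u) = - dot w u.
Proof. by rewrite !(dotC w) dotNl. Qed.

Lemma dotZr c u w : dot w (c *: u) = c * dot w u.
Proof. by rewrite !(dotC w) dotZl. Qed.

Lemma dot0l w : dot 0 w = 0.
Proof. by rewrite -(scale0r w) dotZl mul0r. Qed.

Definition dotE := (dotDl, dotDr, dotNl, dotNr, dotZl, dotZr).

Lemma dot_ge0 u : 0 <= dot u u.
Proof. by apply: sumr_ge0 => j _; rewrite -expr2 sqr_ge0. Qed.

Lemma dot_eq0 u : dot u u = 0 -> u = 0.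
Proof.
move=> /eqP; rewrite psumr_eq0; last by move=> j _; rewrite -expr2 sqr_ge0.
move=> /allP u0; apply/rowP => j; rewrite mxE.
by have := u0 j (mem_index_enum j); rewrite /= mulf_eq0 orbb => /eqP.
Qed.

Lemma enorm_ge0 u : 0 <= enorm u.
Proof. exact: sqrtr_ge0. Qed.

Lemma sqr_enorm u : enorm u ^+ 2 = dot u u.
Proof. by rewrite sqr_sqrtr// dot_ge0. Qed.

Lemma enorm_eq0 u : enorm u = 0 -> u = 0.
Proof. by move=> u0; apply: dot_eq0; rewrite -sqr_enorm u0 expr0n. Qed.

Lemma enormN u : enorm (- u) = enorm u.
Proof. by rewrite /enorm dotNl dotNr opprK. Qed.

Lemma enormB u v : enorm (u - v) = enorm (v - u).
Proof. by rewrite -enormN opprB. Qed.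

Lemma enorm_le_sqr u c : 0 <= c -> dot u u <= c ^+ 2 -> enorm u <= c.
Proof. by move=> c0; rewrite -sqr_enorm ler_pXn2r ?nnegrE// enorm_ge0. Qed.

Lemma cauchy_schwarz u v : dot u v <= enorm u * enorm v.
Proof.
have [u0|u0] := eqVneq (enorm u) 0.
  by rewrite u0 mul0r (enorm_eq0 u0) dot0l.
have [v0|v0] := eqVneq (enorm v) 0.
  by rewrite v0 mulr0 (enorm_eq0 v0) dotC dot0l.
have uv0 : 0 < enorm u * enorm v.
  by rewrite mulr_gt0// lt_neqAle eq_sym ?u0 ?v0 enorm_ge0.
(* This square expands to [2 |u| |v| (|u| |v| - <u, v>)]. *)
have := dot_ge0 (enorm v *: u - enorm u *: v).
rewrite !dotE (dotC v u) -!sqr_enorm => h.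
by rewrite -(ler_pM2l uv0); nra.
Qed.

Lemma cauchy_schwarzN u v : - (enorm u * enorm v) <= dot u v.
Proof. by rewrite lerNl -dotNl -(enormN u) cauchy_schwarz. Qed.

Lemma ler_enormD u v : enorm (u + v) <= enorm u + enorm v.
Proof.
apply: enorm_le_sqr; first by rewrite addr_ge0 ?enorm_ge0.
by have := cauchy_schwarz u v; rewrite !dotE (dotC v u) -!sqr_enorm; nra.
Qed.

Lemma ler_enorm_dist w u v : enorm (u - v) <= enorm (u - w) + enorm (w - v).
Proof. by rewrite -[u - v](subrKA w) ler_enormD. Qed.

(** With [ler_enorm_normr], this transfers boundedness, continuity and convergence between the sup
    norm, which carries the topology, and [enorm]. *)
Lemma ler_normr_enorm u : `|u| <= enorm u.
Proof.
rewrite -[leLHS]/(mx_norm u) mx_normrE; apply/bigmax_leP; split=> [|[i j] _ /=].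
  exact: enorm_ge0.
rewrite (ord1 i) -(@ler_pXn2r _ 2) ?nnegrE ?enorm_ge0//.
rewrite sqr_enorm real_normK ?num_real//.
rewrite /dot (bigD1 j)//= -expr2 lerDl.
by apply: sumr_ge0 => k _; rewrite -expr2 sqr_ge0.
Qed.

Lemma ler_enorm_normr u : enorm u <= Num.sqrt n%:R * `|u|.
Proof.
apply: enorm_le_sqr; first by rewrite mulr_ge0.
have -> : (Num.sqrt n%:R * `|u|) ^+ 2 = \sum_(j < n) `|u| ^+ 2.
  by rewrite exprMn sqr_sqrtr// sumr_const card_ord mulr_natl.
apply: ler_sum => j _.
rewrite -expr2 -real_normK ?num_real// lerXn2r ?nnegrE//.
rewrite -[leRHS]/(mx_norm u) mx_normrE; apply/bigmax_geP; right => /=.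
by exists (0, j).
Qed.

Lemma enorm_lipschitz_continuous (phi : 'rV[R]_n -> R) k :
  (forall x y, phi x - phi y <= k * enorm (x - y)) -> continuous phi.
Proof.
move=> phik x; apply/(@cvgrPdist_lt _ _ _ (nbhs x)) => e e0.
(* A Lipschitz constant for the sup norm; the added 1 makes it positive, so that [e / c] is a valid
   radius. *)
pose c := `|k| * Num.sqrt n%:R + 1.
have c0 : 0 < c by rewrite ltr_wpDl// mulr_ge0.
apply: (filterS _ (nbhsx_ballx x (e / c) _)); last by rewrite divr_gt0.
move=> y; rewrite mx_norm_ball /ball_ /= ltr_pdivlMr// mulrC => xy.
have kn (z : 'rV[R]_n) : k * enorm z <= c * `|z|.
  apply: (@le_trans _ _ (`|k| * enorm z)).
    by apply: ler_wpM2r; [exact: enorm_ge0|exact: ler_norm].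
  rewrite /c mulrDl mul1r -mulrA ler_wpDr//.
  by apply: ler_wpM2l => //; exact: ler_enorm_normr.
apply: le_lt_trans xy.
  rewrite ler_norml lerNl opprB (le_trans (phik _ _))/=; last first.
    by rewrite (distrC x y).
  by rewrite (le_trans (phik _ _)).
Qed.

(** The sublevel set of [phi x0] in [D] is closed, and bounded by the last hypothesis, hence
    compact; points of [D] outside it cannot beat [x0]. *)
Lemma argmin_exists (D : set 'rV[R]_n) (phi : 'rV[R]_n -> R) x0 M :
  closed D -> D x0 -> continuous phi ->
  (forall x, D x -> phi x <= phi x0 -> enorm (x - x0) <= M) ->
  exists w, is_argmin D phi w.
Proof.
move=> clD Dx0 cphi Mphi.
pose A := D `&` phi @^-1` [set r | r <= phi x0].
have clA : closed A.
  apply: closedI => //; apply: preimage_closed; last exact: closed_le.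
  by move=> x _; exact: cphi.
have bA : bounded_set A.
  exists (M + enorm x0); split; first exact: num_real.
  move=> B MB x [Dx phix] /=; rewrite (le_trans (ler_normr_enorm _))//.
  apply: (le_trans _ (ltW MB)).
  rewrite -[x in leLHS](subrK x0) (le_trans (ler_enormD _ _))//.
  by rewrite lerD2r Mphi.
have A0 : A !=set0 by exists x0; split => //=.
have [w wA wmin] := compact_EVT_min A0 (bounded_closed_compact bA clA)
  (continuous_subspaceT cphi).
move: wA; rewrite inE => -[Dw phiw]; exists w; split => // v Dv.
have [phiv|phiv] := leP (phi v) (phi x0); first by apply: wmin; rewrite inE.
exact: le_trans phiw (ltW phiv).
Qed.

(** Instead of iterating [g], minimize the displacement [|g x - x|]: at a minimizer [w] the point
    [g w] has at most [q] times the displacement of [w], which must therefore vanish. *)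
Lemma contraction_fixpoint (g : 'rV[R]_n -> 'rV[R]_n) q : q < 1 ->
  (forall x y, enorm (g x - g y) <= q * enorm (x - y)) -> exists x, g x = x.
Proof.
move=> q1 gq.
pose phi x := enorm (g x - x).
have phi_lip x y : phi x - phi y <= (q + 1) * enorm (x - y).
  rewrite /phi lerBlDr (le_trans (ler_enorm_dist (g y) _ _))//.
  rewrite mulrDl mul1r -addrA lerD// [leRHS]addrC (enormB x y).
  exact: ler_enorm_dist.
have [w [_ wmin]] : exists w, is_argmin setT phi w.
  (* Coercivity: [phi x >= (1 - q) |x| - phi 0], so [phi x <= phi 0] confines [x] to this ball. *)
  apply: (@argmin_exists setT phi 0 (2 * phi 0 / (1 - q))) => //.
    exact: (enorm_lipschitz_continuous phi_lip).
  move=> x _ phix; rewrite ler_pdivlMr ?subr_gt0//.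
  have := ler_enorm_dist (g x) x 0; have := ler_enorm_dist (g 0) (g x) 0.
  by have := gq x 0; have := phix; rewrite /phi (enormB x (g x)); lra.
exists w; apply/eqP; rewrite -subr_eq0; apply/eqP/enorm_eq0.
have := wmin (g w) I; have := gq (g w) w; have := enorm_ge0 (g w - w).
by rewrite /phi; nra.
Qed.

End EuclideanSpace.

Lemma the_uniqueE (T : pointedType) (P : T -> Prop) x :
  P x -> (forall y, P y -> y = x) -> the_unique P = x.
Proof.
move=> Px Pu; apply: get_unique; first by split => // y /Pu.
by move=> y [Py _]; exact: Pu.
Qed.

(** * Projection onto closed convex sets and minimization of quadratics over them *)

Section Projection.
Context {R : realType} {n : nat}.
Implicit Types (u v w x y z : 'rV[R]_n) (D : set 'rV[R]_n).

Definition closed_convex D :=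
  [/\ D !=set0, closed D & @convex_set R 'rV[R]_n D].

Lemma convex_setD D x y t : @convex_set R 'rV[R]_n D -> D x -> D y ->
  0 <= t -> t <= 1 -> D (x + t *: (y - x)).
Proof.
move=> cD Dx Dy t0 t1; have := cD y x (Itv01 t0 t1); rewrite !inE => /(_ Dy Dx).
rewrite /conv /=.
suff -> : x + t *: (y - x) = t *: y + (1 - t) *: x by [].
by rewrite scalerBr scalerBl scale1r addrCA addrA.
Qed.

Lemma projection_exists D z : closed_convex D ->
  exists2 w, D w & forall v, D v -> 0 <= dot (w - z) (v - w).
Proof.
move=> [[x0 Dx0] clD cD].
have [w [Dw wmin]] : exists w, is_argmin D (fun x => enorm (x - z)) w.
  apply: (@argmin_exists _ _ _ _ x0 (2 * enorm (x0 - z))) => //.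
    apply: (@enorm_lipschitz_continuous _ _ _ 1) => x y.
    by rewrite mul1r lerBlDr ler_enorm_dist.
  move=> x _ xz; rewrite (le_trans (ler_enorm_dist z _ _))// (enormB z).
  lra.
exists w => // v Dv; rewrite leNgt; apply/negP => neg.
(* Moving from [w] towards [v] by [t] changes the squared distance to [z] by [- 2 t a + t^2 b]; for
   [t = a / (a + b)] one has [t b <= a], so the change is at most [- t a < 0], against
   minimality. *)
pose a := - dot (w - z) (v - w); pose b := dot (v - w) (v - w).
have b0 : 0 <= b by exact: dot_ge0.
have a0 : 0 < a by rewrite /a oppr_gt0.
have ab0 : 0 < a + b by rewrite ltr_wpDr.
pose t := a / (a + b).
have t0 : 0 < t by rewrite divr_gt0.
have t1 : t <= 1 by rewrite ler_pdivrMr// mul1r lerDl.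
have tb : t * b <= a by rewrite /t mulrAC ler_pdivrMr//; nra.
have := wmin _ (convex_setD cD Dw Dv (ltW t0) t1).
rewrite -(@ler_pXn2r _ 2) ?nnegrE ?enorm_ge0// !sqr_enorm.
have -> : w + t *: (v - w) - z = (w - z) + t *: (v - w) by rewrite addrAC.
rewrite (dotDl (w - z)) !(dotDr (w - z)) !dotZl !dotZr (dotC (v - w) (w - z)) -/b.
have -> : dot (w - z) (v - w) = - a by rewrite /a opprK.
nra.
Qed.

Lemma projection_pythagoras D z w v :
  (forall v, D v -> 0 <= dot (w - z) (v - w)) -> D v ->
  enorm (w - z) ^+ 2 + enorm (v - w) ^+ 2 <= enorm (v - z) ^+ 2.
Proof.
move=> wD /wD; have -> : v - z = (w - z) + (v - w) by rewrite [RHS]addrC subrKA.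
by rewrite !sqr_enorm (dotDl (w - z)) !(dotDr (w - z)) (dotC (v - w) (w - z)); lra.
Qed.

(** The Pythagorean inequality makes [w] the only minimizer, so the definite description behind
    [metric_proj] takes the value [w]. *)
Lemma metric_proj_eq D w z : D w ->
  (forall v, D v -> 0 <= dot (w - z) (v - w)) -> metric_proj D z = w.
Proof.
move=> Dw wD; apply: the_uniqueE; first split => // v Dv.
  rewrite -(@ler_pXn2r _ 2) ?nnegrE ?enorm_ge0//.
  by have := projection_pythagoras wD Dv; have := sqr_ge0 (enorm (v - w)); lra.
move=> v [Dv vmin]; apply/eqP; rewrite -subr_eq0; apply/eqP/dot_eq0.
have := vmin w Dw; rewrite -(@ler_pXn2r _ 2) ?nnegrE ?enorm_ge0//.
have := projection_pythagoras wD Dv; have := dot_ge0 (v - w).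
by rewrite (sqr_enorm (v - w)); lra.
Qed.

Lemma metric_projP D z : closed_convex D ->
  D (metric_proj D z) /\
  forall v, D v -> 0 <= dot (metric_proj D z - z) (v - metric_proj D z).
Proof.
by move=> /(projection_exists z)[w Dw wD]; rewrite (metric_proj_eq Dw wD).
Qed.

Lemma metric_proj_id D z : D z -> metric_proj D z = z.
Proof. by move=> Dz; apply: metric_proj_eq => // v _; rewrite subrr dot0l. Qed.

Lemma metric_proj_argmin D z : closed_convex D ->
  is_argmin D (fun x => enorm (x - z)) (metric_proj D z).
Proof.
move=> cD; have [Dp pP] := metric_projP z cD; split => // v Dv.
rewrite -(@ler_pXn2r _ 2) ?nnegrE ?enorm_ge0//.
by apply: le_trans (projection_pythagoras pP Dv); rewrite lerDl sqr_ge0.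
Qed.

Lemma argmin_metric_proj D z w : closed_convex D ->
  is_argmin D (fun x => enorm (x - z)) w -> metric_proj D z = w.
Proof.
move=> cD [Dw wmin]; have [Dp pP] := metric_projP z cD.
apply/esym/eqP; rewrite -subr_eq0; apply/eqP/dot_eq0.
have := wmin _ Dp; rewrite -(@ler_pXn2r _ 2) ?nnegrE ?enorm_ge0//.
have := projection_pythagoras pP Dw; have := dot_ge0 (w - metric_proj D z).
by rewrite (sqr_enorm (w - metric_proj D z)); lra.
Qed.

Lemma metric_proj_nonexpansive D y z : closed_convex D ->
  enorm (metric_proj D y - metric_proj D z) <= enorm (y - z).
Proof.
move=> cD; have [Dp pP] := metric_projP y cD; have [Dq qP] := metric_projP z cD.
move: (metric_proj D y) (metric_proj D z) Dp pP Dq qP => p q Dp pP Dq qP.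
have [->|pq0] := eqVneq (enorm (p - q)) 0; first exact: enorm_ge0.
have pq_gt0 : 0 < enorm (p - q) by rewrite lt_neqAle eq_sym pq0 enorm_ge0.
rewrite -(ler_pM2r pq_gt0) -expr2 sqr_enorm.
apply: le_trans (cauchy_schwarz _ _).
(* Each projection is tested against the other; the sum is [|p - q|^2 <= <y - z, p - q>]. *)
have := pP q Dq; have := qP p Dp.
by rewrite !dotE (dotC p q); lra.
Qed.

(** Completing the square turns the minimizer into the projection of [- a / kappa]. Both
    minimizations of the inner algorithm have this form. *)
Lemma argmin_quadratic D (g : 'rV[R]_n -> R) kappa a c :
  closed_convex D -> 0 < kappa ->
  (forall v, g v = c + dot a v + kappa / 2 * dot v v) ->
  D (argmin D g) /\
  forall v, D v -> 0 <= dot (a + kappa *: argmin D g) (v - argmin D g).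
Proof.
move=> cD k0 gE; have [w Dw wP] := projection_exists (- (kappa^-1 *: a)) cD.
have wD v : D v -> 0 <= dot (a + kappa *: w) (v - w).
  move=> /wP; rewrite opprK.
  have -> : a + kappa *: w = kappa *: (w + kappa^-1 *: a).
    by rewrite scalerDr scalerA mulfV ?gt_eqF// scale1r addrC.
  by rewrite dotZl => ?; rewrite mulr_ge0// ltW.
suff -> : argmin D g = w by [].
have gw v : D v -> g w + kappa / 2 * dot (v - w) (v - w) <= g v.
  by move=> /wD; rewrite !gE !dotE (dotC v w); lra.
have k20 : 0 < kappa / 2 by rewrite divr_gt0.
apply: the_uniqueE; first split => // v Dv.
  by apply: le_trans (gw v Dv); rewrite lerDl mulr_ge0 ?dot_ge0// ltW.
move=> v [Dv vmin]; apply/eqP; rewrite -subr_eq0; apply/eqP/dot_eq0.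
have := vmin w Dw; have := gw v Dv; have := dot_ge0 (v - w).
by move: (dot (v - w) (v - w)) => d d0 h1 h2; nra.
Qed.

End Projection.

(** * Strongly monotone variational inequalities: existence, uniqueness, dependence on the set *)

Section VariationalInequality.
Context {R : realType} {n : nat}.
Implicit Types (u v w x y z t : 'rV[R]_n) (D : set 'rV[R]_n).
Variables (G : 'rV[R]_n -> 'rV[R]_n) (L mu : R).
Hypotheses (L_gt0 : 0 < L) (mu_gt0 : 0 < mu).

Definition enorm_lipschitz_on D := forall y z, D y -> D z ->
  enorm (G y - G z) <= L * enorm (y - z).

Definition strongly_monotone_on D := forall y z, D y -> D z ->
  mu * enorm (y - z) ^+ 2 <= dot (G y - G z) (y - z).

Definition vi_sol D t := D t /\ forall z, D z -> 0 <= dot (G t) (z - t).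

Lemma vi_sol_unique D s t : strongly_monotone_on D ->
  vi_sol D s -> vi_sol D t -> s = t.
Proof.
move=> mD [Ds sP] [Dt tP].
apply/eqP; rewrite -subr_eq0; apply/eqP/enorm_eq0.
have := mD s t Ds Dt; have := sP t Dt; have := tP s Ds.
rewrite -(opprB s t) dotNr dotDl dotNl => h1 h2 h3.
apply/eqP; rewrite -sqrf_eq0; apply/eqP/le_anti; rewrite sqr_ge0 andbT.
by rewrite -(ler_pM2l mu_gt0) mulr0; lra.
Qed.

(** Solutions are the fixed points of the projected gradient step, a contraction for a suitable
    length. [G] is controlled only on [D], so [g] projects first and is then a contraction of the
    whole space. *)
Lemma vi_sol_exists D : closed_convex D -> enorm_lipschitz_on D ->
  strongly_monotone_on D -> exists t, vi_sol D t.
Proof.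
move=> cD lD mD.
(* with this step the squared contraction factor is at most [q] *)
pose s := mu / (L ^+ 2 + mu ^+ 2); pose q := L ^+ 2 / (L ^+ 2 + mu ^+ 2).
have d0 : 0 < L ^+ 2 + mu ^+ 2 by rewrite addr_gt0// exprn_gt0.
have s0 : 0 < s by rewrite divr_gt0.
have q0 : 0 <= q by rewrite divr_ge0// ltW// exprn_gt0.
have q1 : q < 1 by rewrite ltr_pdivrMr// mul1r ltrDl exprn_gt0.
have sq : 1 - 2 * s * mu + s ^+ 2 * L ^+ 2 <= q.
  have -> : q = 1 - s * mu by rewrite /q /s; field; rewrite gt_eqF.
  have : s * L ^+ 2 <= mu.
    by rewrite /s mulrAC ler_pdivrMr// ler_pM2l// lerDl ltW// exprn_gt0.
  by rewrite -(ler_pM2l s0); lra.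
pose P := metric_proj D.
pose g x := P (P x - s *: G (P x)).
have DP x : D (P x) by case: (metric_projP x cD).
have gP x y : enorm (g x - g y) <= Num.sqrt q * enorm (x - y).
  apply: (@le_trans _ _ (Num.sqrt q * enorm (P x - P y))); last first.
    by rewrite ler_wpM2l// metric_proj_nonexpansive.
  apply: (le_trans (metric_proj_nonexpansive _ _ cD)).
  apply: enorm_le_sqr; first by rewrite mulr_ge0 ?enorm_ge0.
  rewrite exprMn sqr_sqrtr//.
  have := mD _ _ (DP x) (DP y); have := lD _ _ (DP x) (DP y).
  rewrite -(@ler_pXn2r _ 2) ?nnegrE ?enorm_ge0 ?mulr_ge0 ?enorm_ge0 ?(ltW L_gt0)//.
  rewrite exprMn.
  have -> : P x - s *: G (P x) - (P y - s *: G (P y)) =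
    (P x - P y) - s *: (G (P x) - G (P y)).
    by rewrite scalerBr !opprD !opprK addrACA.
  move: (P x - P y) (G (P x) - G (P y)) => d e.
  rewrite !sqr_enorm => h1 h2; rewrite !dotE (dotC d e).
  apply: (@le_trans _ _ ((1 - 2 * s * mu + s ^+ 2 * L ^+ 2) * dot d d)); last first.
    by rewrite ler_wpM2r ?dot_ge0.
  have s2 : s ^+ 2 * dot e e <= s ^+ 2 * (L ^+ 2 * dot d d).
    by rewrite ler_wpM2l// exprn_ge0// ltW.
  have s3 : s * (mu * dot d d) <= s * dot e d by rewrite ler_wpM2l// ltW.
  lra.
have [x gx] : exists x, g x = x.
  apply: (contraction_fixpoint _ gP).
  by rewrite -sqrtr1 ltr_sqrt.
have Dx : D x by rewrite -gx; exact: DP.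
exists x; split => // z Dz.
have [_ /(_ z Dz)] := metric_projP (P x - s *: G (P x)) cD.
rewrite -/P -/(g x) gx (_ : P x = x); last exact: metric_proj_id.
by rewrite opprB addrC subrK dotZl pmulr_rge0.
Qed.

(* Letting the step [s] of the projected gradient tend to infinity gives the
   constant L / mu. *)
Lemma vi_sol_perturbation A D E x y b :
  closed_convex D -> closed_convex E -> D `<=` A -> E `<=` A -> enorm_lipschitz_on A -> strongly_monotone_on A ->
  0 <= b -> vi_sol D x -> vi_sol E y ->
  (forall z, enorm (metric_proj D z - metric_proj E z) <= b) ->
  enorm (x - y) <= L / mu * b.
Proof.
move=> cD cE DA EA lA mA b0 [Dx xP] [Ey yP] DEb.
have [->|xy0] := eqVneq (enorm (x - y)) 0.
  by rewrite mulr_ge0// divr_ge0// ltW.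
have xy_gt0 : 0 < enorm (x - y) by rewrite lt_neqAle eq_sym xy0 enorm_ge0.
have Gxy := lA x y (DA _ Dx) (EA _ Ey).
have key s : 0 < s -> mu * enorm (x - y) <= L * b + s^-1 * b.
  move=> s0.
  (* The projection [w] of the same point onto [E] is then within [b] of [x], and replaces [x] as a
     test point in the inequality solved by [y]. *)
  have xE : metric_proj D (x - s *: G x) = x.
    apply: metric_proj_eq => // v Dv.
    by rewrite opprB addrC subrK dotZl mulr_ge0 ?xP// ltW.
  rewrite -(ler_pM2r xy_gt0); have := DEb (x - s *: G x); rewrite xE.
  have [] := metric_projP (x - s *: G x) cE.
  move: (metric_proj E _) => w Ew wP xwb.
  have := wP y Ey; have := yP w Ew; have := mA x y (DA _ Dx) (EA _ Ey).
  have -> : w - (x - s *: G x) = s *: (G x - s^-1 *: (x - w)).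
    rewrite scalerBr scalerA mulfV ?gt_eqF// scale1r !opprB addrC -addrA.
    by congr (_ + _); rewrite addrC.
  rewrite dotZl pmulr_rge0//.
  have -> : w - y = (x - y) - (x - w) by rewrite opprB [RHS]addrC subrKA.
  have -> : y - w = (x - w) - (x - y) by rewrite opprB [RHS]addrC subrKA.
  have := cauchy_schwarz (x - y) (x - w).
  have := cauchy_schwarz (G x - G y) (x - w).
  have := dot_ge0 (x - w).
  move: (x - w) (x - y) xwb xy_gt0 Gxy => d e db e0 Gxy.
  rewrite expr2; set ne := enorm e in e0 Gxy *; set nd := enorm d in db *.
  rewrite !(dotDr, dotNr, dotDl, dotNl, dotZl) (dotC d e) => d0 cs1 cs2 mon h1 h2.
  have si0 : 0 < s^-1 by rewrite invr_gt0.
  have i1 : s^-1 * dot e d <= s^-1 * (ne * b).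
    apply: ler_wpM2l; first exact: ltW.
    by apply: (le_trans cs2); apply: ler_wpM2l => //; exact: ltW.
  have i2 : 0 <= s^-1 * dot d d by rewrite mulr_ge0// ltW.
  have i3 : enorm (G x - G y) * nd <= L * ne * b.
    by rewrite ler_pM ?enorm_ge0.
  lra.
rewrite mulrAC ler_pdivlMr// mulrC; apply/ler_addgt0Pr => e e0.
(* This length makes the remainder [s^-1 * b] equal to [e * b / (b + 1) <= e]. *)
apply: le_trans (key ((b + 1) / e) _) _; first by rewrite divr_gt0// ltr_wpDl.
rewrite lerD2l invf_div mulrAC ler_pdivrMr ?ltr_wpDl//; nra.
Qed.

End VariationalInequality.

(** * Error bound for the inner algorithm *)

Section InnerAlgorithm.
Context {R : realType} {n : nat}.
Implicit Types (u v w x y z t : 'rV[R]_n) (s : seq (R * 'rV[R]_n)).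
Variables (G : 'rV[R]_n -> 'rV[R]_n) (L mu : R) (D : set 'rV[R]_n).
Hypotheses (L_gt0 : 0 < L) (mu_gt0 : 0 < mu).
Hypotheses (cD : closed_convex D).
Hypotheses (G_lip : enorm_lipschitz_on G L D) (G_mono : strongly_monotone_on G mu D).

Local Notation f := (fun y z => dot (G y) (z - y)).
Local Notation weight s := (\sum_(lw <- s) lw.1).

(** The [w]-update of the inner algorithm: the projected gradient step from [z] of length
    [1 / L]. *)
Definition prox_step z :=
  argmin D (fun w => dot (G z) (w - z) + L / 2 * enorm (w - z) ^+ 2).

(** The estimating function minimized by the [z]-update, for the pairs (lambda_i, w_i) in [s]. *)
Definition estimate s z : R :=
  \sum_(lw <- s) lw.1 * (dot (G lw.2) (z - lw.2) + mu / 2 * enorm (z - lw.2) ^+ 2).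

Lemma prox_stepP z : D (prox_step z) /\
  forall v, D v -> 0 <= dot (G z + L *: (prox_step z - z)) (v - prox_step z).
Proof.
have [] := @argmin_quadratic _ _ D
  (fun w => dot (G z) (w - z) + L / 2 * enorm (w - z) ^+ 2) L (G z - L *: z)
  (L / 2 * dot z z - dot (G z) z) cD L_gt0.
  by move=> v; rewrite sqr_enorm !dotE (dotC z v); field.
rewrite -/(prox_step z) => Dw wP; split => // v /wP.
by rewrite -addrA [- _ + _]addrC -scalerBr.
Qed.

(** With [a = v - w], [b = w - z] and [w] the prox step, optimality of [w] cancels the cross term
    [L <a, b>], and replacing [G z] by [G w] costs [L |a| |b|]; what remains is
    [L / 2 (|a| - |b|)^2]. *)
Lemma prox_step_descent z v : D z -> D v ->
  0 <= L / 2 * dot (v - z) (v - z) +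
       dot (G (prox_step z)) (v - prox_step z).
Proof.
move=> Dz Dv; have [Dw /(_ v Dv)] := prox_stepP z.
move: (prox_step z) Dw => w Dw.
have := G_lip Dw Dz.
have := cauchy_schwarzN (G w - G z) (v - w).
have := enorm_ge0 (w - z); have := enorm_ge0 (v - w).
have := enorm_ge0 (G w - G z).
have -> : v - z = (v - w) + (w - z) by rewrite subrKA.
have := cauchy_schwarz (v - w) (w - z).
move: (v - w) (w - z) => a b; rewrite !dotE -!sqr_enorm (dotC b a).
move: (enorm a) (enorm b) (enorm (G w - G z)) => na nb ng.
move=> cs1 ng0 na0 nb0 cs2 lip opt.
have : ng * na <= L * nb * na by rewrite ler_wpM2r.
have : 0 <= L / 2 * (na - nb) ^+ 2 by rewrite mulr_ge0 ?sqr_ge0// ltW// divr_gt0.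
lra.
Qed.

Lemma estimate_quadratic s : exists c a, forall z,
  estimate s z = c + dot a z + (mu * weight s) / 2 * dot z z.
Proof.
rewrite /estimate; elim: s => [|[l w] s [c [a IH]]].
  by exists 0, 0 => z; rewrite !big_nil dot0l; ring.
exists (c + l * (mu / 2 * dot w w - dot (G w) w)), (a + l *: (G w - mu *: w)) => z.
rewrite !big_cons IH /= sqr_enorm !dotE (dotC w z).
lra.
Qed.

Lemma estimate_argmin s : 0 < weight s ->
  D (argmin D (estimate s)) /\ forall v, D v ->
    estimate s (argmin D (estimate s)) + mu * weight s / 2 *
      dot (v - argmin D (estimate s)) (v - argmin D (estimate s)) <= estimate s v.
Proof.
move=> s0; have [c [a sE]] := estimate_quadratic s.
have [Dw wP] := argmin_quadratic cD (mulr_gt0 mu_gt0 s0) sE.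
split => // v /wP; rewrite !sE; move: (argmin _ _) => w.
by rewrite !dotE (dotC v w); lra.
Qed.

Lemma inner_runS yhat m (s := inner_run f L mu D yhat m) :
  inner_run f L mu D yhat m.+1 =
  rcons s (mu / L * weight s, prox_step (argmin D (estimate s))).
Proof. by []. Qed.

Lemma inner_runP yhat m (s := inner_run f L mu D yhat m)
    (w0 := prox_step yhat) : D yhat ->
  [/\ forall lw, lw \in s -> D lw.2 /\ 0 <= lw.1,
      weight s = (1 + mu / L) ^+ m &
      forall z, D z ->
        - (2 * L ^+ 2 / mu * enorm (w0 - yhat) ^+ 2) <= estimate s z].
Proof.
move=> Dy; rewrite {}/s; elim: m => [|m].
  rewrite /= -/(prox_step yhat) -/w0; have [Dw0 w0P] := prox_stepP yhat.
  split => [lw|| z Dz]; first by rewrite inE => /eqP ->.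
  - by rewrite big_seq1 expr0.
  rewrite /estimate big_seq1 /= mul1r -/w0.
  (* The first term is bounded by the Lipschitz condition, the second by optimality of [w0]; each is
     at least [- L |w0 - yhat| |z - w0|]. Completing the square with [mu / 2 |z - w0|^2] gives the
     constant [2 L^2 / mu]. *)
  have -> : dot (G w0) (z - w0) =
      dot (G w0 - G yhat) (z - w0) + dot (G yhat) (z - w0).
    by rewrite dotDl dotNl subrK.
  have := w0P z Dz; rewrite -/w0 dotDl dotZl; have := G_lip Dw0 Dy; rewrite -/w0.
  have := cauchy_schwarzN (G w0 - G yhat) (z - w0).
  have := cauchy_schwarz (w0 - yhat) (z - w0).
  have := enorm_ge0 (w0 - yhat); have := enorm_ge0 (z - w0).
  move: (enorm (w0 - yhat)) (enorm (z - w0)) (enorm (G _ - _)) => nd nz ng.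
  move=> nz0 nd0 cs1 cs2 lip opt.
  have i1 : ng * nz <= L * nd * nz by rewrite ler_wpM2r.
  have i2 : L * dot (w0 - yhat) (z - w0) <= L * (nd * nz) by rewrite ler_pM2l.
  have i3 : 0 <= mu / 2 * (nz - 2 * L / mu * nd) ^+ 2.
    by rewrite mulr_ge0 ?sqr_ge0// ltW// divr_gt0.
  have i4 : mu / 2 * (nz - 2 * L / mu * nd) ^+ 2 =
    mu / 2 * nz ^+ 2 - 2 * L * nd * nz + 2 * L ^+ 2 / mu * nd ^+ 2.
    by field; rewrite gt_eqF.
  lra.
rewrite inner_runS; move: (inner_run _ _ _ _ _ _) => s [sD sS sB].
have q0 : 0 < mu / L by rewrite divr_gt0.
have S0 : 0 < weight s by rewrite sS exprn_gt0// addr_gt0.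
have [Dz zP] := estimate_argmin S0.
move: (argmin D (estimate s)) Dz zP => z Dz zP.
have [Dw _] := prox_stepP z.
split => [lw|| v Dv].
- rewrite mem_rcons inE => /predU1P[->|/sD//] /=; split => //.
  by rewrite mulr_ge0// ltW.
- by rewrite -cats1 big_cat big_seq1 /= sS exprSr; ring.
rewrite /estimate -cats1 big_cat big_seq1 /= -/(estimate s v).
(* The old bound is used at the minimizer [z] of the old sum; the quadratic growth away from [z]
   pays for the new term through [prox_step_descent]. *)
apply: (le_trans (sB z Dz)); apply: (le_trans _ (lerD (zP v Dv) (lexx _))).
have := prox_step_descent Dz Dv.
move: (prox_step z) => w h.
rewrite -addrA lerDl.
have -> : mu * weight s / 2 * dot (v - z) (v - z) =
  mu / L * weight s * (L / 2 * dot (v - z) (v - z)).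
  by field; rewrite gt_eqF.
rewrite -mulrDr mulr_ge0//; first by rewrite mulr_ge0// ltW.
by rewrite addrA addr_ge0// mulr_ge0 ?sqr_ge0// ltW// divr_gt0.
Qed.

Lemma prox_step_dist y t : D y -> vi_sol G D t ->
  enorm (prox_step y - y) <= 2 * enorm (y - t).
Proof.
move=> Dy [Dt tP]; have [Dw wP] := prox_stepP y.
have [->|d0] := eqVneq (enorm (prox_step y - y)) 0.
  by rewrite mulr_ge0 ?enorm_ge0.
have d_gt0 : 0 < enorm (prox_step y - y) by rewrite lt_neqAle eq_sym d0 enorm_ge0.
rewrite -(ler_pM2l d_gt0) -(ler_pM2l L_gt0).
(* The optimality conditions of the prox step and of [t] are tested against each other. With
   [d = w - y] and [e = y - t] their sum gives [L |d|^2 <= 2 L |d| |e| - mu |e|^2]: one [L |d| |e|]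
   comes from the Lipschitz bound, one from Cauchy-Schwarz. *)
have := wP t Dt; have := tP _ Dw.
move: (prox_step y) d_gt0 => w d_gt0 {Dw wP d0}.
have -> : w - t = (w - y) + (y - t) by rewrite subrKA.
have -> : t - w = - (w - y) - (y - t) by rewrite !opprB [RHS]addrC subrKA.
have := G_mono Dy Dt; have := G_lip Dy Dt.
have := cauchy_schwarzN (G y - G t) (w - y).
have := cauchy_schwarzN (w - y) (y - t).
have := enorm_ge0 (y - t).
move: (w - y) (y - t) d_gt0 => d e d_gt0.
rewrite !dotE -!sqr_enorm.
move: (enorm (G y - G t)) (enorm d) (enorm e) d_gt0 => ng nd ne d_gt0.
move: (dot d e) => de e0 cs1 cs2 lip mono h1 h2.
have i1 : ng * nd <= L * ne * nd by rewrite ler_wpM2r// ltW.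
have i2 : - (L * (nd * ne)) <= L * de by rewrite -mulrN ler_pM2l.
have i3 : 0 <= mu * ne ^+ 2 by rewrite mulr_ge0 ?sqr_ge0// ltW.
lra.
Qed.

Lemma inner_output_dist yhat m t : D yhat -> vi_sol G D t ->
  (1 + mu / L) ^+ m * enorm (inner_output f L mu D yhat m - t) ^+ 2
    <= (4 * (L / mu) * enorm (yhat - t)) ^+ 2.
Proof.
move=> Dy tS; have := prox_step_dist Dy tS; have [Dt tP] := tS.
rewrite /inner_output; have [] := inner_runP m Dy.
move: (inner_run _ _ _ _ _ _) (prox_step yhat) => s w0 sD <- sB w0y.
have [S0|S0] := eqVneq (weight s) 0; first by rewrite S0 mul0r sqr_ge0.
set o := _ *: _ - t.
have oE : weight s *: o = \sum_(lw <- s) lw.1 *: (lw.2 - t).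
  rewrite /o scalerBr scalerA mulfV// scale1r scaler_suml -sumrB.
  by apply: eq_bigr => lw _; rewrite scalerBr.
move: o oE => o oE.
(* Strong monotonicity bounds each term of the estimate at [t] by [- mu / 2 |e|^2] with
   [e = w_i - t]. Jensen's inequality enters through its tangent form [|e|^2 >= 2 <o, e> - |o|^2],
   where [o] is the weighted mean of the [e]. *)
have : \sum_(lw <- s) lw.1 * (mu / 2 * (2 * dot o (lw.2 - t) - dot o o))
    <= - estimate s t.
  rewrite /estimate -[leRHS]sumrN [leLHS]big_seq [leRHS]big_seq.
  apply: ler_sum => lw /sD[Dw l0].
  rewrite -mulrN ler_wpM2l//.
  have := G_mono Dw Dt; have := tP _ Dw.
  rewrite (enormB t) -(opprB lw.2) dotNr dotDl dotNl !sqr_enorm.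
  move: (lw.2 - t) => e.
  have : 0 <= mu / 2 * dot (e - o) (e - o).
    by rewrite mulr_ge0 ?dot_ge0// divr_ge0// ltW.
  by rewrite !dotE (dotC e o); lra.
have -> : \sum_(lw <- s) lw.1 * (mu / 2 * (2 * dot o (lw.2 - t) - dot o o)) =
    mu / 2 * (weight s * dot o o).
  have -> : weight s * dot o o = 2 * dot o (weight s *: o) - weight s * dot o o.
    by have := dotZr (weight s) o o; lra.
  have -> : dot o (weight s *: o) = \sum_(lw <- s) lw.1 * dot o (lw.2 - t).
    rewrite oE (big_morph (dot o) (fun a b => dotDr a b o) (_ : dot o 0 = 0)).
      by apply: eq_bigr => lw _; rewrite dotZr.
    by rewrite dotC dot0l.
  rewrite mulr_sumr mulr_suml -sumrB mulr_sumr; apply: eq_bigr => lw _; ring.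
have := sB t Dt; rewrite (sqr_enorm o) => h1 h2.
have : mu / 2 * (weight s * dot o o) <= 2 * L ^+ 2 / mu * enorm (w0 - yhat) ^+ 2.
  by lra.
have h3 : enorm (w0 - yhat) ^+ 2 <= 4 * enorm (yhat - t) ^+ 2.
  have -> : 4 * enorm (yhat - t) ^+ 2 = (2 * enorm (yhat - t)) ^+ 2 by ring.
  by rewrite ler_pXn2r ?nnegrE ?mulr_ge0 ?enorm_ge0.
have h4 : 2 * L ^+ 2 / mu * enorm (w0 - yhat) ^+ 2 <=
    2 * L ^+ 2 / mu * (4 * enorm (yhat - t) ^+ 2).
  by rewrite ler_wpM2l// divr_ge0 ?mulr_ge0 ?sqr_ge0// ltW.
move=> h5; have h6 := le_trans h5 h4.
have m2 : 0 < mu / 2 by rewrite divr_gt0.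
rewrite -(ler_pM2l m2); apply: (le_trans h6); rewrite le_eqVlt; apply/orP; left.
by apply/eqP; field; rewrite gt_eqF.
Qed.

End InnerAlgorithm.

Lemma inner_steps_ge {R : realType} (L mu alpha : R) :
  0 < L -> 0 < mu -> alpha * L < mu ->
  (20 * L / (mu - alpha * L)) ^+ 2 <= (1 + mu / L) ^+ inner_steps L mu alpha.
Proof.
move=> L0 mu0 aL.
have q0 : 0 < 20 * L / (mu - alpha * L) by rewrite divr_gt0 ?mulr_gt0// subr_gt0.
have b0 : 0 < 1 + mu / L by rewrite addr_gt0// divr_gt0.
have r0 : 0 < mu / (L + mu) by rewrite divr_gt0// addr_gt0.
rewrite -[in leLHS](lnK q0) -expRM_natl.
rewrite -[in leRHS](lnK b0) -expRM_natl ler_expR.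
(* Obtained from [ln (1 + x) <= x] at [x = - mu / (L + mu)], since [1 + x] is the inverse of
   [1 + mu / L]. *)
have lnb : mu / (L + mu) <= ln (1 + mu / L).
  rewrite -[ln _]opprK lerNr -lnV//.
  have -> : (1 + mu / L)^-1 = 1 + - (mu / (L + mu)).
    by field; rewrite !gt_eqF ?addr_gt0.
  by apply: le_ln1Dx; rewrite ltrN2 ltr_pdivrMr ?addr_gt0// mul1r ltrDr.
set l := ln _; pose q := 2 * (L + mu) / mu * l.
have qN : q <= (inner_steps L mu alpha)%:R.
  apply: (le_trans (ceil_ge _)).
  rewrite /inner_steps -/l -/q natr_absz ger0_norm ?le_max ?lexx//.
  by rewrite ler_int le_max lexx orbT.
have -> : 2 * l = q * (mu / (L + mu)).
  by rewrite /q; field; rewrite !gt_eqF ?addr_gt0.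
apply: (@le_trans _ _ ((inner_steps L mu alpha)%:R * (mu / (L + mu)))).
  by rewrite ler_wpM2r// ltW.
by rewrite ler_wpM2l.
Qed.

(** * Contraction of the projected solution map and convergence of the outer algorithm *)

Section OuterAlgorithm.
Context {R : realType} {n : nat}.
Implicit Types (u v w x y z t : 'rV[R]_n).
Variables (G : 'rV[R]_n -> 'rV[R]_n) (L mu alpha : R).
Variables (A X : set 'rV[R]_n) (KK : 'rV[R]_n -> set 'rV[R]_n).
Hypotheses (L_gt0 : 0 < L) (mu_gt0 : 0 < mu) (alpha_gt0 : 0 < alpha).
Hypothesis alpha_lt : alpha < mu / L.
Hypotheses (cX : closed_convex X) (cK : forall x, X x -> closed_convex (KK x)).
Hypothesis KA : forall x, X x -> KK x `<=` A.
Hypotheses (G_lip : enorm_lipschitz_on G L A) (G_mono : strongly_monotone_on G mu A).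
Hypothesis K_contract : forall u v z, X u -> X v ->
  enorm (metric_proj (KK u) z - metric_proj (KK v) z) <= alpha * enorm (u - v).

Local Notation f := (fun y z => dot (G y) (z - y)).
Local Notation delta := (1 - alpha * (L / mu)).
Local Notation T := (fun x => the_unique (vi_sol G (KK x))).
Local Notation N := (inner_steps L mu alpha).
Local Notation y_ := (outer_y f L mu X KK N).
Local Notation x_ := (outer_x f L mu X KK N).

Lemma delta_gt0 : 0 < delta.
Proof.
by rewrite subr_gt0 mulrA ltr_pdivrMr// mul1r -ltr_pdivlMr.
Qed.

Lemma delta_lt1 : delta < 1.
Proof. by rewrite ltrBlDr ltrDl mulr_gt0// divr_gt0. Qed.

Lemma vi_solP x : X x -> vi_sol G (KK x) (T x).
Proof.
move=> Xx.
have lK : enorm_lipschitz_on G L (KK x).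
  by move=> y z /(KA Xx) ? /(KA Xx) ?; exact: G_lip.
have mK : strongly_monotone_on G mu (KK x).
  by move=> y z /(KA Xx) ? /(KA Xx) ?; exact: G_mono.
have [t tS] := vi_sol_exists L_gt0 mu_gt0 (cK Xx) lK mK.
suff -> : T x = t by [].
by apply: the_uniqueE => // s sS; exact: (vi_sol_unique mu_gt0 mK sS tS).
Qed.

Lemma vi_sol_lipschitz u v : X u -> X v ->
  enorm (T u - T v) <= (1 - delta) * enorm (u - v).
Proof.
move=> Xu Xv.
have -> : (1 - delta) * enorm (u - v) = L / mu * (alpha * enorm (u - v)) by ring.
apply: (@vi_sol_perturbation _ _ G L mu L_gt0 mu_gt0 A (KK u) (KK v)) => //.
- exact: cK.
- exact: cK.
- exact: KA.
- exact: KA.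
- by rewrite mulr_ge0 ?enorm_ge0// ltW.
- exact: vi_solP.
- exact: vi_solP.
- by move=> z; exact: K_contract.
Qed.

Lemma projected_fixpoint_unique x y : X x -> X y ->
  metric_proj X (T x) = x -> metric_proj X (T y) = y -> x = y.
Proof.
move=> Xx Xy xE yE; apply/eqP; rewrite -subr_eq0; apply/eqP/enorm_eq0.
have := metric_proj_nonexpansive (T x) (T y) cX.
have := vi_sol_lipschitz Xx Xy; have := enorm_ge0 (x - y); have := delta_gt0.
by rewrite xE yE; nra.
Qed.

Lemma projected_fixpoint_exists :
  exists2 x, X x & metric_proj X (T x) = x.
Proof.
have PX x : X (metric_proj X x) by case: (metric_projP x cX).
(* [T] is Lipschitz only on [X]; projecting first gives a contraction defined everywhere. *)
have [x xE] : exists x, metric_proj X (T (metric_proj X x)) = x.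
  apply: (@contraction_fixpoint _ _ _ (1 - delta)).
    by rewrite ltrBlDr ltrDl delta_gt0.
  move=> x y; apply: (le_trans (metric_proj_nonexpansive _ _ cX)).
  apply: (le_trans (vi_sol_lipschitz (PX x) (PX y))).
  rewrite ler_wpM2l ?metric_proj_nonexpansive// subr_ge0 ltW//; exact: delta_lt1.
have Xx : X x by rewrite -xE.
by exists x => //; rewrite -{2}xE (metric_proj_id Xx).
Qed.

Lemma inner_output_rate x y : X x -> KK x y ->
  enorm (inner_output f L mu (KK x) y N - T x) <= delta / 5 * enorm (y - T x).
Proof.
move=> Xx Ky.
have lK : enorm_lipschitz_on G L (KK x).
  by move=> ? ? /(KA Xx) ? /(KA Xx) ?; exact: G_lip.
have mK : strongly_monotone_on G mu (KK x).
  by move=> ? ? /(KA Xx) ? /(KA Xx) ?; exact: G_mono.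
have := inner_output_dist L_gt0 mu_gt0 (cK Xx) lK mK N Ky (vi_solP Xx).
have aL : alpha * L < mu by rewrite -ltr_pdivlMr.
have := inner_steps_ge L_gt0 mu_gt0 aL.
move: (enorm _) (enorm_ge0 (inner_output f L mu (KK x) y N - T x)) => e e0.
have := enorm_ge0 (y - T x); move: (enorm _) => a a0 h1 h2.
have q0 : 0 < 20 * L / (mu - alpha * L) by rewrite divr_gt0 ?mulr_gt0// subr_gt0.
have : (20 * L / (mu - alpha * L) * e) ^+ 2 <= (4 * (L / mu) * a) ^+ 2.
  by rewrite exprMn (le_trans _ h2)// ler_wpM2r// sqr_ge0.
rewrite ler_pXn2r ?nnegrE//; last 2 first.
- by rewrite mulr_ge0// ltW.
- by rewrite mulr_ge0// mulr_ge0// divr_ge0// ltW.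
(* As [delta = (mu - alpha L) / mu], the product of [20 L / (mu - alpha L)] and [delta / 5] is
   exactly [4 L / mu]. *)
move=> h3; rewrite -(ler_pM2l q0); apply: (le_trans h3).
rewrite le_eqVlt; apply/orP; left; apply/eqP; field.
by rewrite (gt_eqF mu_gt0) subr_eq0 gt_eqF.
Qed.

(** Passing through [T x], the inner error contributes the factor [delta / 5] and the shift of [T]
    contributes [(1 - delta) (1 + delta / 5)]; their sum [1 - 3 delta / 5 - delta^2 / 5] is below
    [1 - delta / 2]. *)
Lemma outer_y_contract y0 k :
  enorm (y_ y0 k.+1 - T (x_ y0 k.+1)) <=
    (1 - delta / 2) * enorm (y_ y0 k - T (x_ y0 k)).
Proof.
have PX x : X (metric_proj X x) by case: (metric_projP x cX).
pose x := x_ y0 k; pose x' := x_ y0 k.+1; pose y := y_ y0 k; pose y' := y_ y0 k.+1.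
rewrite -/x -/x' -/y -/y'.
have Xx : X x by exact: PX.
have Xx' : X x' by exact: PX.
have [Ky _] := metric_projP y (cK Xx); have [KT _] := vi_solP Xx.
have d0 := delta_gt0; have d1 := delta_lt1.
have h1 : enorm (y' - T x) <= delta / 5 * enorm (y - T x).
  apply: (le_trans (inner_output_rate Xx Ky)).
  (* [T x] lies in [KK x], so replacing [y] by its projection onto [KK x] brings it no farther from
     [T x]. *)
  rewrite ler_wpM2l ?divr_ge0// ?(ltW d0)//.
  by rewrite -{1}(metric_proj_id KT) metric_proj_nonexpansive//; exact: cK.
have h2 : enorm (T x - T x') <= (1 - delta) * enorm (x - x').
  exact: vi_sol_lipschitz.
have h3 : enorm (x - x') <= enorm (y - y') by exact: metric_proj_nonexpansive.
clearbody x x' y y'.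
have h4 := ler_enorm_dist (T x) y y'; rewrite (enormB (T x) y') in h4.
have h5 := ler_enorm_dist (T x) y' (T x').
have := enorm_ge0 (y - T x).
move: (enorm (y - T x)) h1 h4 => e h1 h4 e0.
have h6 : enorm (x - x') <= e + delta / 5 * e by lra.
have h7 : (1 - delta) * enorm (x - x') <= (1 - delta) * (e + delta / 5 * e).
  by rewrite ler_wpM2l// subr_ge0 ltW.
have h8 : 0 <= delta * e by rewrite mulr_ge0// ltW.
have h9 : 0 <= delta * (delta * e) by rewrite mulr_ge0// ltW.
by apply: (le_trans h5); lra.
Qed.

Lemma outer_y_dist y0 k : enorm (y_ y0 k - T (x_ y0 k)) <=
  expR (- (delta / 2) * k%:R) * enorm (y0 - T (x_ y0 0%N)).
Proof.
have d2 : 0 <= 1 - delta / 2 by have := delta_lt1; lra.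
elim: k => [|k IH]; first by rewrite mulr0 expR0 mul1r.
apply: (le_trans (outer_y_contract y0 k)).
rewrite -[k.+1%:R]natr1 mulrDr mulr1 expRD [expR _ * expR _]mulrC -mulrA.
apply: ler_pM; [exact: d2|exact: enorm_ge0|exact: expR_ge1Dx|exact: IH].
Qed.

(** [|x_k - xbar| <= |y_k - T xbar| <= |y_k - T x_k| + (1 - delta) |x_k - xbar|]; absorbing the last
    term produces [delta^-1]. *)
Lemma outer_x_dist y0 xbar k : X xbar -> metric_proj X (T xbar) = xbar ->
  enorm (x_ y0 k - xbar) <=
    delta^-1 * expR (- (delta / 2) * k%:R) * enorm (y0 - T (x_ y0 0%N)).
Proof.
move=> Xxbar xbarE.
have Xx : X (x_ y0 k) by case: (metric_projP (y_ y0 k) cX).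
rewrite -mulrA mulrC ler_pdivlMr ?delta_gt0//.
apply: le_trans (outer_y_dist y0 k).
have := metric_proj_nonexpansive (y_ y0 k) (T xbar) cX; rewrite xbarE.
have := ler_enorm_dist (T (x_ y0 k)) (y_ y0 k) (T xbar).
have := vi_sol_lipschitz Xx Xxbar.
rewrite -/(x_ y0 k); lra.
Qed.

Lemma outer_x_cvg y0 xbar : X xbar -> metric_proj X (T xbar) = xbar ->
  x_ y0 k @[k --> \oo] --> xbar.
Proof.
move=> Xxbar xbarE.
pose c := delta^-1 * enorm (y0 - T (x_ y0 0%N)).
pose r := expR (- (delta / 2)).
have r0 : 0 < r by exact: expR_gt0.
have r1 : r < 1 by rewrite expR_lt1 oppr_lt0 divr_gt0// delta_gt0.
have rc : c * r ^+ k @[k --> \oo] --> (0 : R).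
  rewrite -(mulr0 c); apply: cvgMl_tmp; apply: cvg_expr.
  by rewrite ger0_norm// ltW.
apply/cvgrPdist_lt => e e0; near=> k.
rewrite (le_lt_trans (ler_normr_enorm _))// enormB.
apply: (le_lt_trans (outer_x_dist y0 k Xxbar xbarE)).
rewrite mulrAC -/c expRM_natr -/r; apply: (le_lt_trans (ler_norm _)).
by near: k; exact: cvgr0_norm_lt.
Unshelve. all: by end_near. Qed.

End OuterAlgorithm.

(** * First-order conditions along a direction *)

Section DirectionalDerivative.
Context {R : realType}.

(** The bound is asked only for [t] in (0, 1], the part of the line that stays in a convex set
    containing [y] and [y + v]. *)
Lemma ler_derive {V : normedModType R} (g : V -> R) (y v : V) (c : R) :
  derivable g y v ->
  (forall t, 0 < t -> t <= 1 -> c * t <= g (y + t *: v) - g y) -> c <= 'D_v g y.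
Proof.
move=> dg gc; rewrite leNgt; apply/negP => Dc.
have e0 : 0 < c - 'D_v g y by rewrite subr_gt0.
have /cvgrPdist_lt /(_ _ e0) := dg.
rewrite near_withinE => /nbhs_ballP[d /= d0 dP].
pose t := Num.min (d / 2) 1.
have t0 : 0 < t by rewrite lt_min ltr01 divr_gt0.
have t1 : t <= 1 by rewrite ge_min lexx orbT.
have td : t < d.
  rewrite (@le_lt_trans _ _ (d / 2))//; first by rewrite ge_min lexx.
  by rewrite ltr_pdivrMr// ltr_pMr// ltr1n.
have := dP t; rewrite -ball_normE /= sub0r normrN gtr0_norm// => /(_ td).
move=> /(_ (lt0r_neq0 t0)).
rewrite -/('D_v g y) [t *: v + y]addrC.
have := gc t t0 t1; rewrite -ler_pdivlMr// [_ / t]mulrC => h1.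
by rewrite ltr_norml => /andP[+ _]; rewrite -[_ *: _]/(_ * _); lra.
Qed.

Lemma derive_gradient {n} (g : 'rV[R]_n -> R) y v : differentiable g y ->
  'D_v g y = dot (gradient g y) v.
Proof.
move=> dg; rewrite deriveE// {1}(row_sum_delta v) linear_sum /=.
by apply: eq_bigr => j _; rewrite linearZ /= mxE deriveE// mulrC.
Qed.

End DirectionalDerivative.

(** * Strategy profiles by blocks; Nash equilibria as solutions of a variational inequality *)

Section Profiles.
Context {R : realType} {p : nat} {n_ : 'I_p -> nat}.
Local Notation E := (profile R n_).
Implicit Types (x y z : E) (S : forall i, set 'rV[R]_(n_ i)).

Lemma dot_submxrow x y : dot x y = \sum_i dot (submxrow x i) (submxrow y i).
Proof.
have dotmx m (u v : 'rV[R]_m) : dot u v = (u *m v^T) 0 0.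
  by rewrite mxE; apply: eq_bigr => j _; rewrite mxE.
rewrite dotmx -{1}(submxrowK x) -{1}(submxrowK y) tr_mxrow mul_mxrow_mxcol summxE.
by apply: eq_bigr => i _; rewrite dotmx.
Qed.

Lemma vi_bifunctionE (theta : 'I_p -> E -> R) y z :
  vi_bifunction theta y z = dot (pseudo_gradient theta y) (z - y).
Proof.
rewrite dot_submxrow; apply: eq_bigr => i _.
by rewrite /pseudo_gradient mxrowK submxrowB.
Qed.

Lemma submxrow_continuous i : continuous (fun x => submxrow x i).
Proof.
move=> x; apply/(@cvgrPdist_lt _ _ _ (nbhs x)) => e e0.
apply: (filterS _ (nbhsx_ballx x e e0)) => y.
rewrite mx_norm_ball /ball_ /= => xy; apply: le_lt_trans xy.
rewrite -[leLHS]/(mx_norm (submxrow x i - submxrow y i)) mx_normrE.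
apply/bigmax_leP; split => //= -[a b] _ /=.
rewrite -submxrowB mxE -[leRHS]/(mx_norm (x - y)) mx_normrE.
by apply/bigmax_geP; right; exists (a, tagnat.Rank i b).
Qed.

Lemma closed_convex_prod_set S :
  (forall i, closed_convex (S i)) -> closed_convex (prod_set S).
Proof.
move=> cS; split.
- have S0 i : exists u, S i u by case: (cS i).
  exists (\mxrow_i projT1 (cid (S0 i))) => i; rewrite mxrowK.
  exact: projT2 (cid (S0 i)).
- have -> : prod_set S = \bigcap_(i in setT) (fun x => submxrow x i) @^-1` (S i).
    by apply/seteqP; split => [x Sx i _|x Sx i]; exact: Sx.
  apply: closed_bigI => i _; apply: preimage_closed; last by case: (cS i).
  by move=> x _; exact: submxrow_continuous.
- move=> x y t; rewrite !inE => Sx Sy i.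
  have [_ _ /(_ (submxrow x i) (submxrow y i) t)] := cS i.
  rewrite !inE => /(_ (Sx i) (Sy i)); congr (S i _).
  by apply/matrixP => a b; rewrite !mxE.
Qed.

Lemma submxrow_deviate x i (u : 'rV[R]_(n_ i)) j :
  submxrow (deviate x u) j = eqtype.dfwith (fun j => submxrow x j) u j.
Proof. by rewrite mxrowK. Qed.

Lemma prod_set_deviate S y i (u : 'rV[R]_(n_ i)) :
  prod_set S y -> S i u -> prod_set S (deviate y u).
Proof.
move=> Sy Su j; rewrite submxrow_deviate.
by case: eqtype.dfwithP.
Qed.

Lemma deviate_submxrow y i : deviate y (submxrow y i) = y.
Proof.
apply/mxrowP => j; rewrite submxrow_deviate.
by case: eqtype.dfwithP.
Qed.

Lemma dot_deviate g y i (u : 'rV[R]_(n_ i)) :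
  dot g (deviate y u - y) = dot (submxrow g i) (u - submxrow y i).
Proof.
rewrite dot_submxrow (bigD1 i)//= submxrowB submxrow_deviate eqtype.dfwith_in.
rewrite big1 ?addr0// => j ji.
by rewrite submxrowB submxrow_deviate eqtype.dfwith_out 1?eq_sym// subrr dotC dot0l.
Qed.

(** Along this segment only player [i] moves, so concavity in, and feasibility of, that player's own
    variable apply. *)
Lemma deviate_line y i (u : 'rV[R]_(n_ i)) t :
  y + t *: (deviate y u - y) =
  deviate y (submxrow y i + t *: (u - submxrow y i)).
Proof.
have submxrowZ c x j : submxrow (c *: x) j = c *: submxrow x j.
  by apply/matrixP => a b; rewrite !mxE.
apply/mxrowP => j; rewrite submxrowD submxrowZ submxrowB !submxrow_deviate.
have [<-|ij] := eqVneq i j; first by rewrite !eqtype.dfwith_in.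
by rewrite !eqtype.dfwith_out// subrr scaler0 addr0.
Qed.

(** Forward, the first-order conditions of the players add up. Backward, a unilateral deviation as
    test point isolates one player's condition, and concavity makes it sufficient. *)
Lemma nash_equilibrium_vi (theta : 'I_p -> E -> R) S y :
  (forall i x, differentiable (theta i) x) ->
  (forall i, concave_function (fun u : 'rV[R]_(n_ i) => theta i (deviate y u))) ->
  (forall i, @convex_set R 'rV[R]_(n_ i) (S i)) ->
  nash_equilibrium S theta y <-> vi_sol (pseudo_gradient theta) (prod_set S) y.
Proof.
move=> dtheta ctheta cS.
have DE i u : 'D_(deviate y u - y) (theta i) y =
    dot (submxrow (gradient (theta i) y) i) (u - submxrow y i).
  by rewrite derive_gradient// dot_deviate.
split => -[Sy yP]; split => //.
- move=> z Sz; rewrite -vi_bifunctionE; apply: sumr_ge0 => i _.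
  have dg := @diff_derivable _ _ _ _ _ (deviate y (submxrow z i) - y) (dtheta i y).
  rewrite dotNl -DE -(deriveN dg).
  apply: ler_derive => [|t t0 t1]; first exact: derivableN.
  rewrite mul0r deviate_line -[_ - _]/(- _ - - _) opprK addrC subr_ge0.
  by apply: yP; exact: (convex_setD (@cS i) (Sy i) (Sz i) (ltW t0) t1).
- move=> i u Su; rewrite -subr_le0.
  apply: (@le_trans _ _ ('D_(deviate y u - y) (theta i) y)).
    (* By concavity the increment of [theta i] along the segment dominates that of the chord. *)
    apply: ler_derive => [|t t0 t1]; first exact: diff_derivable.
    have := ctheta i (Itv01 (ltW t0) t1) u (submxrow y i).
    rewrite !in_setT => /(_ isT isT).
    rewrite /conv /= deviate_submxrow deviate_line.
    have -> : submxrow y i + t *: (u - submxrow y i) =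
      t *: u + (1 - t) *: submxrow y i.
      by rewrite scalerBr scalerBl scale1r addrCA addrA.
    rewrite -[leRHS]/(t * - theta i (deviate y u) + (1 - t) * - theta i y).
    rewrite -[unstable.onem t]/(1 - t); lra.
  have := yP _ (prod_set_deviate Sy Su); rewrite dot_deviate DE.
  by rewrite /pseudo_gradient mxrowK dotNl oppr_ge0.
Qed.

End Profiles.

(** * Projected solutions as fixed points, and assembly of the result *)

Lemma distance_inf_argmin {R : realType} {n} (D : set 'rV[R]_n) x y :
  closed_convex D -> D x ->
  enorm (x - y) = inf [set enorm (y' - y) | y' in D] <-> metric_proj D y = x.
Proof.
move=> cD Dx.
have lb : has_lbound [set enorm (y' - y) | y' in D].
  by exists 0 => _ [v _ <-]; exact: enorm_ge0.
split => [xy|<-].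
  apply: argmin_metric_proj => //; split => // v Dv; rewrite xy.
  by apply: ge_inf => //; exists v.
have [Dp pmin] := metric_proj_argmin y cD.
apply/eqP; rewrite eq_le; apply/andP; split; last first.
  by apply: ge_inf => //; exists (metric_proj D y).
apply: lb_le_inf; first by exists (enorm (x - y)), x.
by move=> _ [v Dv <-]; exact: pmin.
Qed.

Theorem corollary5p1 (R : realType) (p : nat) (n_ : 'I_p -> nat)
  (C : forall i : 'I_p, set 'rV[R]_(n_ i))
  (K : forall i : 'I_p, profile R n_ -> set 'rV[R]_(n_ i))
  (theta : 'I_p -> profile R n_ -> R)
  (L mu alpha : R)
  (C_nonempty : forall i, C i !=set0)
  (C_closed : forall i, closed (C i))
  (C_convex : forall i, @convex_set R 'rV[R]_(n_ i) (C i))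
  (K_nonempty : forall i x, prod_set C x -> K i x !=set0)
  (K_closed : forall i x, prod_set C x -> closed (K i x))
  (K_convex : forall i x, prod_set C x -> @convex_set R 'rV[R]_(n_ i) (K i x))
  (theta_C1 : forall i, continuously_differentiable (theta i))
  (theta_concave : forall i x,
     concave_function (fun u : 'rV[R]_(n_ i) => theta i (deviate x u)))
  (L_gt0 : 0 < L)
  (G_lipschitz : forall y z, ambient C K y -> ambient C K z ->
     enorm (pseudo_gradient theta y - pseudo_gradient theta z)
       <= L * enorm (y - z))
  (mu_gt0 : 0 < mu)
  (f_monotone : forall x y, ambient C K x -> ambient C K y ->
     vi_bifunction theta x y + vi_bifunction theta y x <= - mu * enorm (x - y) ^+ 2)
  (alpha_gt0 : 0 < alpha)
  (alpha_lt : alpha < mu / L)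
  (K_contract : forall u v z : profile R n_, prod_set C u -> prod_set C v ->
     enorm (metric_proj (feasible K u) z - metric_proj (feasible K v) z)
       <= alpha * enorm (u - v)) :
  let f := vi_bifunction theta in
  let delta := 1 - alpha * (L / mu) in
  let x_ := outer_x f L mu (prod_set C) (feasible K) (inner_steps L mu alpha) in
  let T := VI_solution K f in
  exists xbar : profile R n_,
    [/\ projected_solution C K theta xbar,
        (forall x, projected_solution C K theta x -> x = xbar) &
        forall y0 : profile R n_,
          x_ y0 k @[k --> \oo] --> xbar /\
          forall k : nat,
            enorm (x_ y0 k - xbar)
              <= delta^-1 * expR (- (delta / 2) * k%:R)
                 * enorm (y0 - T (x_ y0 0%N))].

Proof.
move=> f delta x_ T.
pose G := pseudo_gradient theta; pose X := prod_set C; pose A := ambient C K.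
have fE : f = fun y z => dot (G y) (z - y).
  by apply/funext => y; apply/funext => z; exact: vi_bifunctionE.
have cX : closed_convex X by apply: closed_convex_prod_set => i; split.
have cK x : X x -> closed_convex (feasible K x).
  move=> Xx; apply: closed_convex_prod_set => i.
  by split; [exact: K_nonempty|exact: K_closed|exact: K_convex].
have KA x : X x -> feasible K x `<=` A.
  move=> Xx y Ky; apply: subset_closure; apply: sub_gen_smallest.
  by exists x.
(* [f y z + f z y = - <G y - G z, y - z>], so the monotonicity of [f] is strong monotonicity of
   [G]. *)
have G_mono : strongly_monotone_on G mu A.
  move=> y z Ay Az; have := f_monotone y z Ay Az.
  rewrite -/f fE mulNr lerNr => /le_trans; apply.
  by rewrite -(opprB z y) !dotE; lra.
have TE x : T x = the_unique (vi_sol G (feasible K x)) by rewrite /T fE.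
have TS x : X x -> vi_sol G (feasible K x) (T x).
  by rewrite TE; exact: (vi_solP L_gt0 mu_gt0 cK KA G_lipschitz G_mono).
(* Uniqueness for the variational inequality forces the equilibrium witnessing a projected solution
   [x] to be [T x]. *)
have projE x : projected_solution C K theta x <->
    X x /\ metric_proj X (T x) = x.
  have nashE y : X x -> nash_equilibrium (fun i => K i x) theta y <->
      vi_sol G (feasible K x) y.
    move=> Xx; apply: nash_equilibrium_vi => i; last exact: K_convex.
      by case: (theta_C1 i).
    exact: theta_concave.
  split => [[Xx [y [Ky xy /(nashE _ Xx) yS]]]|[Xx xE]].
    split => //.
    have mK : strongly_monotone_on G mu (feasible K x).
      by move=> u v /(KA _ Xx) ? /(KA _ Xx) ?; exact: G_mono.
    rewrite -(vi_sol_unique mu_gt0 mK yS (TS _ Xx)).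
    exact/(distance_inf_argmin _ cX Xx).
  split => //; exists (T x); split.
  - by case: (TS _ Xx).
  - exact/(distance_inf_argmin _ cX Xx).
  - by apply/nashE => //; exact: TS.
have [xbar Xxbar xbarE] := projected_fixpoint_exists L_gt0 mu_gt0 alpha_gt0
  alpha_lt cX cK KA G_lipschitz G_mono K_contract.
exists xbar; split.
- by apply/projE; rewrite TE.
- move=> x /projE[Xx]; rewrite TE => xE.
  exact: (projected_fixpoint_unique L_gt0 mu_gt0 alpha_gt0 alpha_lt cX cK KA
    G_lipschitz G_mono K_contract Xx Xxbar xE xbarE).
- move=> y0; rewrite /x_ fE; split => [|k].
    exact: (outer_x_cvg L_gt0 mu_gt0 alpha_gt0 alpha_lt cX cK KA G_lipschitz
      G_mono K_contract y0 Xxbar xbarE).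
  rewrite TE; exact: (outer_x_dist L_gt0 mu_gt0 alpha_gt0 alpha_lt cX cK KA
    G_lipschitz G_mono K_contract y0 k Xxbar xbarE).
Qed.
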